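(* For a graphon $W$ the following are equivalent: (i) $W$ has finite diameter; (ii) there exist $N\in\mathbb{N}$ and $\varepsilon>0$ such that for every measurable $A\subseteq[0,1]$ with $\lambda(A)\ge\frac12$, $\lambda(A\cup\Gamma_\varepsilon(A)\cup\Gamma_\varepsilon^2(A)\cup\dots\cup\Gamma^N_\varepsilon(A))=1$; (iii) $W$ is connected and there exists $\delta>0$ such that $\deg_W(x)\ge\delta$ for almost every $x$.
   Context: A graphon is a Lebesgue measurable symmetric $W:[0,1]^2\to[0,1]$; $\lambda$ is Lebesgue measure, $\deg_W(x)=\int_0^1W(x,y)dy$. $W$ is connected if there is no measurable partition $[0,1]=A\cup B$ with $\lambda(A),\lambda(B)>0$ and $W(x,y)=0$ for a.e. $(x,y)\in A\times B$. For measurable $A$ and $\varepsilon>0$, $\Gamma_\varepsilon(A)=\{x\in[0,1]:\int_AW(y,x)dy\ge\varepsilon\}$, and $\Gamma_\varepsilon^k$ is the $k$-fold iterate. $W$ has finite diameter if there is $N\in\mathbb{N}$ such that for every measurable $A$ with $\lambda(A)>0$ there exists $\varepsilon>0$ with $\lambda(A\cup\Gamma_\varepsilon(A)\cup\dots\cup\Gamma^N_\varepsilon(A))=1$. *)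

(* Defs.v *)
From HB Require Import structures.
From mathcomp Require Import all_boot all_order all_algebra.
From mathcomp Require Import all_classical all_reals all_analysis.
Set Implicit Arguments.
Unset Strict Implicit.
Unset Printing Implicit Defensive.
Import Order.TTheory GRing.Theory Num.Theory.
Import numFieldNormedType.Exports.
Local Open Scope classical_set_scope.
Local Open Scope ring_scope.
Local Open Scope ereal_scope.

(* The canonical measurable structure on R is the Borel one. The types below
   are R and R * R with their Lebesgue sigma-algebras; on R it is the domain
   of the library's completed_lebesgue_measure. *)
Notation lebesgue_line R :=
  (caratheodory_type (@wlength R idfun)^*%mu).

Notation lebesgue_plane R :=
  (caratheodory_type
     (@lebesgue_measure R \x @lebesgue_measure R)^*%mu).

(* Completion of the product of the Borel-Lebesgue measures: the library
   builds completed_lebesgue_measure from interval length in the same way. *)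
Definition completed_lebesgue_measure2 {R : realType} :
    set (lebesgue_plane R) -> \bar R :=
  @completed_measure_extension _ _ _ (@lebesgue_measure R \x @lebesgue_measure R).

HB.instance Definition _ (R : realType) :=
  Measure.on (@completed_lebesgue_measure2 R).

Definition unit_interval {R : realType} : set R := `[0%R, 1%R]%classic.

(* Only the values on the unit square are constrained, and no definition
   below uses any other value. *)
Record graphon (R : realType) := Graphon {
  graphon_fun :> R -> R -> R ;
  graphon_measurable :
    measurable_fun
      (unit_interval `*` unit_interval : set (lebesgue_plane R))
      (fun z : lebesgue_plane R => graphon_fun z.1 z.2) ;
  graphon_sym : forall x y : R, unit_interval x -> unit_interval y ->
    graphon_fun x y = graphon_fun y x ;
  graphon_range : forall x y : R, unit_interval x -> unit_interval y ->
    (0 <= graphon_fun x y <= 1)%R }.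

Section graphon_notions.
Context {R : realType}.
Implicit Types (W : graphon R) (A B : set R).

Local Notation lambda := (@completed_lebesgue_measure R).
Local Notation lambda2 := (@completed_lebesgue_measure2 R).

Definition unit_measurable A : Prop :=
  A `<=` unit_interval /\ measurable (A : set (lebesgue_line R)).

(* Sections of a Lebesgue measurable function are Lebesgue measurable only for
   almost every x; at the remaining x the library's integral is the lower
   integral. *)
Definition gdeg W (x : R) : \bar R :=
  \int[lambda]_(y in (unit_interval : set (lebesgue_line R))) (W x y)%:E.

Definition gconnected W : Prop :=
  ~ exists A B : set R,
      [/\ unit_measurable A, unit_measurable B,
          A `|` B = unit_interval & A `&` B = set0] /\
      [/\ 0 < lambda A, 0 < lambda B &
          {ae lambda2, forall z, (A `*` B) z -> W z.1 z.2 = 0%R}].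

Definition Gamma W (eps : R) A : set R :=
  [set x | unit_interval x /\
           eps%:E <= \int[lambda]_(y in (A : set (lebesgue_line R))) (W y x)%:E].

Definition Gamma_upto W (eps : R) (N : nat) A : set R :=
  \bigcup_(k in `I_N.+1) iter k (Gamma W eps) A.

Definition finite_diameter W : Prop :=
  exists N : nat, forall A, unit_measurable A -> 0 < lambda A ->
    exists2 eps : R, (0 < eps)%R & lambda (Gamma_upto W eps N A) = 1.

End graphon_notions.

(* Main.v *)
Require Import Defs.
From HB Require Import structures.
From mathcomp Require Import all_boot all_order all_algebra.
From mathcomp Require Import all_classical all_reals all_analysis.
From mathcomp Require Import measurable_realfun ring lra.
Set Implicit Arguments.
Unset Strict Implicit.
Unset Printing Implicit Defensive.
Import Order.TTheory GRing.Theory Num.Theory.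
Import numFieldNormedType.Exports.
Local Open Scope classical_set_scope.
Local Open Scope ring_scope.
Local Open Scope ereal_scope.

(**
Each of (i), (ii) implies that every set [A] of measure at least 1/2 reaches
almost everything in finitely many steps with some threshold [eps > 0]. Points
outside [A] of degree below [eps] are never reached, so applying this to the
two halves of [0, 1] bounds the degree from below; a set without outgoing
edges reaches only itself, so [W] is connected.

Conversely let [W] be connected with degrees at least [delta], and write
[cut A] for the integral of [W] over [A * ~A]. The heart of the proof is that
[cut] is bounded below on the sets of measure between [delta/2] and
[1 - delta/2]. Suppose that such sets exist with arbitrarily small cut.
Splitting a set of small cut by another one into two parts of measure at least
[delta/2] removes mass [delta/2], so it cannot be iterated: some [A0] is not
split by any set of small enough cut. A set of small cut has measure either
below [delta/8] or at least [delta/2], so up to complements each of these sets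
contains [A0] up to measure [delta/8], and so do their finite intersections if
the sum of the cuts is small. The inferior limit of a sequence of them with
summable cuts then has measure neither 0 nor 1, and it has cut 0 by
Borel-Cantelli, a contradiction.

Given the lower bound on cuts, the reached set grows by a fixed amount at each
step until its measure exceeds [1 - delta/2], and one more step reaches almost
every point. This is uniform in [A] of measure at least [delta/2], and one step
with threshold [delta * lambda(A) / 2] brings any non-null [A] to this case.
*)

(** * Finite measures with real values, and densities *)

Section real_measure.
Context d (T : measurableType d) (R : realType).
Context (mu : {finite_measure set T -> \bar R}).
Implicit Types A B : set T.

(** Real values bring the later estimates within reach of [lra] and [nra]; nothing is lost because
    [mu] is finite. *)
Definition rmeasure A : R := fine (mu A).

Lemma rmeasureE A : measurable A -> (rmeasure A)%:E = mu A.
Proof. by move=> mA; rewrite fineK// fin_num_measure. Qed.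

Lemma rmeasure_ge0 A : (0 <= rmeasure A)%R.
Proof. exact: fine_ge0. Qed.

Lemma le_rmeasure A B : measurable A -> measurable B -> A `<=` B ->
  (rmeasure A <= rmeasure B)%R.
Proof.
by move=> mA mB AB; rewrite -lee_fin !rmeasureE// le_measure// inE.
Qed.

Lemma rmeasureID A B : measurable A -> measurable B ->
  (rmeasure A = rmeasure (A `&` B) + rmeasure (A `\` B))%R.
Proof.
move=> mA mB; apply: EFin_inj; rewrite EFinD !rmeasureE//.
- by rewrite addeC -measureDI.
- exact: measurableD.
- exact: measurableI.
Qed.

Lemma rmeasureU2 A B : measurable A -> measurable B ->
  (rmeasure (A `|` B) <= rmeasure A + rmeasure B)%R.
Proof.
move=> mA mB; rewrite -lee_fin EFinD !rmeasureE//; last exact: measurableU.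
exact: measureU2.
Qed.

Lemma rmeasure_bigcup_le (F : (set T)^nat) n (c : R) :
  (forall k, measurable (F k)) -> (forall k, (k < n)%N -> (rmeasure (F k) <= c)%R) ->
  (rmeasure (\bigcup_(k in `I_n) F k) <= n%:R * c)%R.
Proof.
move=> mF; elim: n => [|n IH] Fc.
  by rewrite II0 bigcup_set0 /rmeasure measure0 mul0r.
rewrite IIS bigcup_setU bigcup_set1.
apply: (le_trans (rmeasureU2 _ _)) => //.
  by apply: bigcup_measurable => k _.
rewrite -natr1 mulrDl mul1r lerD//; last exact: Fc.
by apply: IH => k kn; apply: Fc; exact: (leq_trans kn).
Qed.

Lemma rmeasure_nd_bigcup_le (F : (set T)^nat) (c : R) :
  (forall k, measurable (F k)) -> nondecreasing_seq F ->
  (forall k, (rmeasure (F k) <= c)%R) -> (rmeasure (\bigcup_k F k) <= c)%R.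
Proof.
move=> mF ndF Fc.
have mU : measurable (\bigcup_k F k) by exact: bigcupT_measurable.
rewrite -lee_fin rmeasureE//.
have cF := nondecreasing_cvg_mu (mu := mu) mF mU ndF.
rewrite -(cvg_lim _ cF)//; apply: lime_le; first by apply/cvg_ex; eexists; exact: cF.
by apply: nearW => k /=; rewrite -rmeasureE// lee_fin.
Qed.

End real_measure.

Section real_probability.
Context d (T : measurableType d) (R : realType) (P : probability T R).
Implicit Types A : set T.
Local Notation p := (rmeasure P).

Lemma rprobability_setT : p setT = 1%R.
Proof. exact: (congr1 fine (probability_setT P)). Qed.

Lemma rprobability_setC A : measurable A -> (p (~` A) = 1 - p A)%R.
Proof.
move=> mA; have := rmeasureID P measurableT mA.
by rewrite rprobability_setT setTI setTD => ->; lra.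
Qed.

Lemma rprobability_le1 A : measurable A -> (p A <= 1)%R.
Proof. by move=> mA; rewrite -rprobability_setT; exact: le_rmeasure. Qed.

End real_probability.

Section density.
Context d (T : measurableType d) (R : realType) (mu : subprobability T R).
Context (f : T -> R).

Definition density (mf : measurable_fun setT f)
    (f01 : forall x, (0 <= f x <= 1)%R) (A : set T) : \bar R :=
  \int[mu]_(x in A) (f x)%:E.

Context (mf : measurable_fun setT f) (f01 : forall x, (0 <= f x <= 1)%R).
Local Notation nu := (density mf f01).

Let f_ge0 x : (0 <= f x)%R. Proof. by have /andP[] := f01 x. Qed.

Let density0 : nu set0 = 0. Proof. exact: integral_set0. Qed.

Let density_ge0 A : 0 <= nu A.
Proof. by apply: integral_ge0 => x _; rewrite lee_fin. Qed.

Let density_sigma_additive : semi_sigma_additive nu.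
Proof.
apply: semi_sigma_additive_nng_induced => [|x]; last by rewrite lee_fin.
exact/measurable_EFinP.
Qed.

HB.instance Definition _ := isMeasure.Build _ _ _ nu
  density0 density_ge0 density_sigma_additive.

Lemma density_le A : measurable A -> nu A <= mu A.
Proof.
move=> mA; rewrite -[leRHS]mul1e -integral_cst//; apply: ge0_le_integral => //.
- by move=> x _; rewrite lee_fin.
- by apply/measurable_EFinP; exact: measurable_funTS.
- by move=> x _; rewrite lee_fin; have /andP[] := f01 x.
Qed.

Let density_fin : fin_num_fun nu.
Proof.
move=> A mA; rewrite ge0_fin_numE//; apply: le_lt_trans (density_le mA) _.
by rewrite -ge0_fin_numE// fin_num_measure.
Qed.

HB.instance Definition _ := Measure_isFinite.Build _ _ _ nu density_fin.

End density.

(** * Symmetric kernels on a probability space *)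

Section kernel.
Context d (T : measurableType d) (R : realType) (P : probability T R).
Context (V : T -> T -> R).
Context (mV : measurable_fun setT (fun z : T * T => V z.1 z.2)).
Context (V01 : forall x y, (0 <= V x y <= 1)%R).
Context (Vsym : forall x y, V x y = V y x).
Implicit Types A B : set T.

Let mVl x : measurable_fun setT (V ^~ x).
Proof.
have := measurableT_comp mV (pair2_measurable x).
by apply: eq_measurable_fun.
Qed.

Let V01l x y : (0 <= V y x <= 1)%R. Proof. exact: V01. Qed.
Let V012 (z : T * T) : (0 <= V z.1 z.2 <= 1)%R. Proof. exact: V01. Qed.

(** [kappa A x] below is the weight that [x] receives from [A]. Making it and the edge weights
    values of finite measures provides additivity and monotonicity. *)
Definition kappa_measure x : {finite_measure set T -> \bar R} :=
  density P (mVl x) (V01l x).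
Definition edge_measure : {finite_measure set (T * T)%type -> \bar R} :=
  density (product_subprobability (P : subprobability T R, P : subprobability T R))
    mV V012.

Local Notation p := (rmeasure P).
Local Notation kappa A x := (rmeasure (kappa_measure x) A).
Local Notation e A B := (rmeasure edge_measure (A `*` B)).

Lemma kappaE A x : measurable A ->
  (kappa A x)%:E = \int[P]_(y in A) (V y x)%:E.
Proof. by move=> mA; rewrite rmeasureE. Qed.

Lemma kappa_le A x : measurable A -> (kappa A x <= p A)%R.
Proof. by move=> mA; rewrite -lee_fin !rmeasureE// density_le. Qed.

Let mE A B : measurable A -> measurable B ->
  measurable_fun setT ((fun z : T * T => (V z.1 z.2)%:E) \_ (A `*` B)).
Proof.
move=> mA mB; apply/(measurable_restrictT _ (measurableX mA mB)).
by apply/measurable_EFinP; exact: measurable_funTS.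
Qed.

Let E_ge0 A B z : 0 <= ((fun z : T * T => (V z.1 z.2)%:E) \_ (A `*` B)) z.
Proof.
by rewrite patchE; case: ifP => // _; rewrite lee_fin; have /andP[] := V01 z.1 z.2.
Qed.

Lemma edgeE A B : measurable A -> measurable B ->
  (e A B)%:E = \int[P]_(x in B) (kappa A x)%:E.
Proof.
move=> mA mB; rewrite rmeasureE; last exact: measurableX.
rewrite [LHS]integral_mkcond.
rewrite [LHS](fubini_tonelli2 (m1 := P) (m2 := P) _ (mE mA mB) (E_ge0 A B)).
rewrite [RHS]integral_mkcond; apply: eq_integral => y _.
rewrite patchE; case: ifPn => yB.
  rewrite kappaE// [RHS]integral_mkcond; apply: eq_integral => x _.
  by rewrite !patchE/= in_setX/= yB andbT.
apply: integral0_eq => x _.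
by rewrite patchE/= in_setX/= (negbTE yB) andbF.
Qed.

(** Tonelli in the order opposite to [edgeE]; the symmetry of [V] identifies the inner integrals. *)
Lemma edge_sym A B : measurable A -> measurable B -> e A B = e B A.
Proof.
move=> mA mB; apply: EFin_inj; rewrite (edgeE mB mA) rmeasureE; last exact: measurableX.
rewrite [LHS]integral_mkcond.
rewrite [LHS](fubini_tonelli1 (m1 := P) (m2 := P) _ (mE mA mB) (E_ge0 A B)).
rewrite [RHS]integral_mkcond; apply: eq_integral => y _.
rewrite patchE; case: ifPn => yA.
  rewrite kappaE// [RHS]integral_mkcond; apply: eq_integral => x _.
  by rewrite !patchE/= in_setX/= yA /= Vsym.
apply: integral0_eq => x _.
by rewrite patchE/= in_setX/= (negbTE yA).
Qed.

Lemma edge_le A B : measurable A -> measurable B -> (e A B <= p A * p B)%R.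
Proof.
move=> mA mB; have mAB := measurableX mA mB.
rewrite -lee_fin EFinM !rmeasureE//; apply: (le_trans (density_le _ _ _ mAB)).
by rewrite /= product_measure1E.
Qed.

Lemma measurable_kappa A : measurable A -> measurable_fun setT (fun x => kappa A x).
Proof.
move=> mA; apply/measurable_EFinP.
have := measurable_fun_fubini_tonelli_G (m1 := P) _ (mE mA measurableT) (E_ge0 A setT).
apply: eq_measurable_fun => y _ /=.
rewrite kappaE// [RHS]integral_mkcond; apply: eq_integral => x _.
by rewrite !patchE/= in_setX/= in_setT andbT.
Qed.

End kernel.

(** * Cuts between a set and its complement *)

Section cut.
Context d (T : measurableType d) (R : realType) (P : probability T R).
Context (V : T -> T -> R).
Context (mV : measurable_fun setT (fun z : T * T => V z.1 z.2)).
Context (V01 : forall x y, (0 <= V x y <= 1)%R).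
Context (Vsym : forall x y, V x y = V y x).
Implicit Types A B : set T.

Local Notation p := (rmeasure P).
Local Notation kappa A x := (rmeasure (kappa_measure P mV V01 x) A).
Local Notation nu := (edge_measure P mV V01).
Local Notation e A B := (rmeasure nu (A `*` B)).
Local Notation cut A := (e A (~` A)).

Lemma cutC A : measurable A -> cut (~` A) = cut A.
Proof.
by move=> mA; rewrite setCK edge_sym//; exact: measurableC.
Qed.

(** A pair that leaves the intersection leaves [A] if its second point misses [A], and leaves [B]
    otherwise. *)
Lemma cutI A B : measurable A -> measurable B ->
  (cut (A `&` B) <= cut A + cut B)%R.
Proof.
move=> mA mB; have [mA' mB'] := (measurableC mA, measurableC mB).
have mI := measurableI _ _ mA mB.
apply: le_trans (rmeasureU2 _ (measurableX mA mA') (measurableX mB mB')).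
apply: le_rmeasure.
- by apply: measurableX => //; exact: measurableC.
- by apply: measurableU; exact: measurableX.
- move=> [x y] /= [[Ax Bx]].
  by have [Ay|nAy] := pselect (A y) => nABy; [right|left]; split => // By; exact: nABy.
Qed.

Lemma cutD A B : measurable A -> measurable B ->
  (cut (A `\` B) <= cut A + cut B)%R.
Proof.
move=> mA mB; rewrite setDE -(cutC mB); apply: cutI => //.
exact: measurableC.
Qed.

Lemma edge_split A B C : measurable A -> measurable B -> measurable C ->
  (e A B = e A (B `&` C) + e A (B `\` C))%R.
Proof.
move=> mA mB mC; rewrite (rmeasureID nu (measurableX mA mB) (measurableX mA mC)).
congr (_ + _)%R; congr (rmeasure nu _); apply/seteqP; split => [[x y]|[x y]] /=.
- by move=> [[Ax By] [_ Cy]].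
- by move=> [Ax [By Cy]].
- by move=> [[Ax By] nC]; split => //; split => // Cy; exact: nC.
- by move=> [Ax [By nCy]]; split => // -[].
Qed.

Section min_degree.
Context (delta : R) (delta0 : (0 < delta)%R).
Context (deg_ge : {ae P, forall x, (delta <= kappa setT x)%R}).

Lemma mass_degree_le A : measurable A -> (delta * p A <= e A setT)%R.
Proof.
move=> mA; rewrite (edge_sym _ _ _ Vsym mA measurableT).
rewrite -lee_fin edgeE// EFinM rmeasureE// -integral_cst//.
apply: ae_ge0_le_integral => //.
- by move=> x _; rewrite lee_fin ltW.
- by move=> x _; rewrite lee_fin rmeasure_ge0.
- by apply/measurable_EFinP/measurable_funTS/measurable_kappa.
- by apply: filterS deg_ge => x dx _; rewrite lee_fin.
Qed.

(* A set with few outgoing edges must contain most of the neighbourhoods of its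
   points, so it cannot be of small positive measure. *)
Lemma small_cut_dichotomy A : measurable A -> (cut A <= delta ^+ 2 / 32)%R ->
  (p A < delta / 8)%R \/ (delta / 2 <= p A)%R.
Proof.
move=> mA cA; have := mass_degree_le mA; have := edge_le P mV V01 mA mA.
rewrite (edge_split mA measurableT mA) setTI setTD.
have [|pA] := ltP (p A) (delta / 8)%R; first by left.
have [|pA'] := leP (delta / 2)%R (p A); first by right.
move: (e A A) (cut A) (p A) cA pA pA' => x c q cA pA pA' h1 h2.
(* Here [delta * q - q ^+ 2 <= c <= delta ^+ 2 / 32], whereas [delta / 8 <= q < delta / 2] makes the
   left side at least [delta ^+ 2 / 16]. *)
exfalso; move: delta0 => d0; nra.
Qed.

Lemma unsplittable_exists :
  (forall eta : R, (0 < eta)%R -> exists A, [/\ measurable A, (delta / 2 <= p A)%R,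
     (p A <= 1 - delta / 2)%R & (cut A <= eta)%R]) ->
  exists2 eta : R, (0 < eta <= delta ^+ 2 / 64)%R & exists A0,
    [/\ measurable A0, (cut A0 <= eta)%R, (delta / 2 <= p A0)%R &
     forall B, measurable B -> (cut B <= eta)%R ->
       (p (A0 `&` B) < delta / 2)%R \/ (p (A0 `\` B) < delta / 2)%R].
Proof.
move=> S; apply: contrapT => H.
have split_ (eta : R) A : (0 < eta <= delta ^+ 2 / 64)%R ->
    measurable A -> (cut A <= eta)%R -> (delta / 2 <= p A)%R ->
    exists B, [/\ measurable B, (cut B <= eta)%R,
    (delta / 2 <= p (A `&` B))%R & (delta / 2 <= p (A `\` B))%R].
  move=> eta0 mA cA pA; apply: contrapT => nB; apply: H; exists eta => //.
  exists A; split => // B mB cB; apply: contrapT => /not_orP[/negP h1 /negP h2].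
  by apply: nB; exists B; split; rewrite // leNgt.
have small n (eta : R) : (0 < eta <= delta ^+ 2 / 64)%R -> exists A,
    [/\ measurable A, (cut A <= eta)%R, (delta / 2 <= p A)%R &
        (p A <= 1 - n%:R * (delta / 2))%R].
  elim: n eta => [|n IH] eta eta0.
    have [A [mA pA pA1 cA]] := S eta (andP eta0).1.
    by exists A; split => //; move: delta0 pA1; lra.
  (* The cut of an intersection is at most the sum of the cuts, so the set and its splitter are both
     taken with half the tolerance. *)
  have eta2 : (0 < eta / 2 <= delta ^+ 2 / 64)%R by apply/andP; split; lra.
  have [A [mA cA pA pAn]] := IH _ eta2.
  have [B [mB cB pB pB']] := split_ _ _ eta2 mA cA pA.
  exists (A `&` B); split => //; first exact: measurableI.
  - by have := cutI mA mB; lra.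
  - have := rmeasureID P mA mB; rewrite -natr1; lra.
(* For this [n] the upper bound [1 - n%:R * (delta / 2)] is negative. *)
pose n := (Num.truncn (2 / delta)).+1.
have [|A [_ _ pA]] := small n (delta ^+ 2 / 64)%R.
  by rewrite lexx andbT; apply: divr_gt0 => //; exact: exprn_gt0.
have : (2 / delta < n%:R)%R by exact: truncnS_gt.
by rewrite ltr_pdivrMr// => h; move: delta0; lra.
Qed.

Context (connected : forall A, measurable A -> cut A = 0%R ->
  p A = 0%R \/ p A = 1%R).

(* [F n] are the sets of small cut, [G n] is [F n] or its complement, whichever
   almost contains the unsplittable [A0], and [L] is the inferior limit of [G]. *)
Lemma cut_lower_bound : exists2 beta : R, (0 < beta)%R &
  forall A, measurable A -> (delta / 2 <= p A)%R -> (p A <= 1 - delta / 2)%R ->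
    (beta <= cut A)%R.
Proof.
apply: contrapT => H.
have S (eta : R) : (0 < eta)%R -> exists A, [/\ measurable A, (delta / 2 <= p A)%R,
     (p A <= 1 - delta / 2)%R & (cut A <= eta)%R].
  move=> eta0; apply: contrapT => nA; apply: H; exists eta => // A mA pA pA'.
  by rewrite leNgt; apply/negP => cA; apply: nA; exists A; split => //; exact: ltW.
have [eta /andP[eta0 eta1] [A0 [mA0 cA0 pA0 A0split]]] := unsplittable_exists S.
(* These tolerances sum to [eta], which bounds the cut of every finite intersection of the [G n] and
   later feeds Borel-Cantelli. *)
have eta2 n : (0 < eta / (2 ^ n.+1)%:R)%R by rewrite divr_gt0// ltr0n expn_gt0.
have [F hF] := choice (fun n => S _ (eta2 n)).
have mF n : measurable (F n) by have [] := hF n.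
have mF' n : measurable (~` F n) by exact: measurableC.
pose G n := if (p (A0 `\` F n) < delta / 8)%R then F n else ~` F n.
have mG n : measurable (G n) by rewrite /G; case: ifP.
have cG n : (cut (G n) <= eta / (2 ^ n.+1)%:R)%R.
  by rewrite /G; case: ifP => _; rewrite ?cutC//; have [] := hF n.
have pG n : (p (G n) <= 1 - delta / 2)%R.
  rewrite /G; have [_ h1 h2 _] := hF n; case: ifP => _ //.
  by rewrite rprobability_setC//; lra.
(* As [A0] is not split by [F n], one of its two parts has measure below [delta / 2]; the cut of
   that part is at most [2 * eta <= delta ^+ 2 / 32], so the dichotomy pushes its measure below
   [delta / 8]. *)
have pA0G n : (p (A0 `\` G n) < delta / 8)%R.
  rewrite /G; case: ifPn => // /negP nh; rewrite setDE setCK.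
  have cF : (cut (F n) <= eta)%R.
    have [_ _ _ /le_trans] := hF n; apply.
    by rewrite ler_pdivrMr ?ltr0n ?expn_gt0// ler_peMr ?ler1n ?expn_gt0// ltW.
  have [] := A0split _ (mF n) cF => h.
    have cI : (cut (A0 `&` F n) <= delta ^+ 2 / 32)%R.
      by have := cutI mA0 (mF n); lra.
    have [//|] := small_cut_dichotomy (measurableI _ _ mA0 (mF n)) cI.
    by rewrite leNgt h.
  have cD : (cut (A0 `\` F n) <= delta ^+ 2 / 32)%R.
    by have := cutD mA0 (mF n); lra.
  have [//|] := small_cut_dichotomy (measurableD mA0 (mF n)) cD.
  by rewrite leNgt h.
pose B n := \bigcap_(k in `I_n) G k.
have mB n : measurable (B n) by exact: bigcap_measurableType.
have BS n : B n.+1 = B n `&` G n by rewrite /B IIS bigcap_setU bigcap_set1.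
have cB n : (cut (B n) <= eta - eta / (2 ^ n)%:R)%R.
  elim: n => [|n IH].
    by rewrite /B II0 bigcap_set0 setCT setX0 /rmeasure measure0 expn0 divr1 subrr.
  rewrite BS; apply: (le_trans (cutI (mB n) (mG n))).
  have := cG n; rewrite expnS natrM invfM; lra.
(* One more intersection raises the loss to less than [delta / 4]. The lost part still has small
   cut, so the dichotomy brings it back below [delta / 8]. *)
have pA0B n : (p (A0 `\` B n) < delta / 8)%R.
  elim: n => [|n IH].
    by rewrite /B II0 bigcap_set0 setDT /rmeasure measure0 /=; move: delta0; lra.
  have mA0B := measurableD mA0 (mB n.+1).
  have cA0B : (cut (A0 `\` B n.+1) <= delta ^+ 2 / 32)%R.
    have := cutD mA0 (mB n.+1); have := cB n.+1; have := ltW (eta2 n); lra.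
  have [//|] := small_cut_dichotomy mA0B cA0B.
  have : (p (A0 `\` B n.+1) <= p (A0 `\` B n) + p (A0 `\` G n))%R.
    rewrite BS setDIr; apply: rmeasureU2; exact: measurableD.
  by have := pA0G n; move: delta0; lra.
pose L := \bigcup_n \bigcap_(k >= n) G k.
have mI n : measurable (\bigcap_(k >= n) G k) by exact: bigcap_measurableType.
have mL : measurable L by exact: bigcup_measurable.
have pL_le : (p L <= 1 - delta / 2)%R.
  apply: rmeasure_nd_bigcup_le => // [m n mn|n].
    by apply/subsetPset; move=> x Gx k /= nk; apply: Gx; exact: leq_trans nk.
  apply: le_trans (pG n); apply: le_rmeasure => //.
  by apply: bigcap_inf => /=.
(* The intersection of all [G k] already contains [A0] up to [delta / 8], hence has measure at least
   [3 * delta / 8]. *)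
have pL_gt : (0 < p L)%R.
  have mI0 := mI 0%N.
  have : (p (A0 `\` \bigcap_(k >= 0) G k) <= delta / 8)%R.
    have -> : A0 `\` \bigcap_(k >= 0) G k = \bigcup_n (A0 `\` B n).
      apply/seteqP; split => x.
        move=> [A0x]; apply: contra_notP => nx k _ /=; apply: contrapT => nGx.
        by apply: nx; exists k.+1 => //; split => // /(_ k (ltnSn k)).
      move=> [n _ [A0x nBx]]; split => // Gx; apply: nBx => k _; exact: Gx.
    apply: rmeasure_nd_bigcup_le => [n|m n mn|n].
    - exact: measurableD.
    - apply/subsetPset; apply: setDS => x Gx k /= km; apply: Gx.
      exact: leq_trans mn.
    - exact: ltW.
  have := rmeasureID P mA0 mI0.
  have : (p (A0 `&` \bigcap_(k >= 0) G k) <= p L)%R.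
    apply: le_rmeasure => //; first exact: measurableI.
    by move=> x [_ Gx]; exists 0%N.
  by move: delta0; lra.
have cL : cut L = 0%R.
  pose E k := G k `*` ~` G k.
  have mE k : measurable (E k) by apply: measurableX => //; exact: measurableC.
  have mL' : measurable (L `*` ~` L) by apply: measurableX => //; exact: measurableC.
  have E0 : nu (lim_sup_set E) = 0.
    apply: lim_sup_set_cvg0 => //.
    apply: (@le_lt_trans _ _ (\sum_(k <oo) (eta / (2 ^ k.+1)%:R)%:E)).
      apply: lee_nneseries => // k _.
      by have := cG k; rewrite -lee_fin (rmeasureE nu (mE k)).
    apply: (le_lt_trans (epsilon_trick0 xpredT (ltW eta0))).
    by rewrite ltry.
  apply/eqP; rewrite eq_le rmeasure_ge0 andbT -lee_fin rmeasureE// -[leRHS]E0.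
  apply: le_measure; rewrite ?inE//.
    by apply: bigcap_measurableType => k _; exact: bigcup_measurable.
  (* [x] lies in every [G k] from [m] on, while [y], being outside [L], misses some [G k] beyond any
     index; so the pair lies in infinitely many [E k]. *)
  move=> [x y] /= [[m _ Lx] nLy] n _ /=.
  apply: contrapT => nE; apply: nLy; exists (maxn m n) => // k /= mnk.
  apply: contrapT => nGy; apply: nE; exists k => /=.
    by apply: leq_trans mnk; exact: leq_maxr.
  split => //=; apply: Lx => /=; apply: leq_trans mnk; exact: leq_maxl.
have [] := connected mL cL; move: delta0; lra.
Qed.

End min_degree.
End cut.

(** * Iterated neighbourhoods *)

Section expansion.
Context d (T : measurableType d) (R : realType) (P : probability T R).
Context (V : T -> T -> R).
Context (mV : measurable_fun setT (fun z : T * T => V z.1 z.2)).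
Context (V01 : forall x y, (0 <= V x y <= 1)%R).
Context (Vsym : forall x y, V x y = V y x).
Implicit Types (A B : set T) (eps : R).

Local Notation p := (rmeasure P).
Local Notation kappa A x := (rmeasure (kappa_measure P mV V01 x) A).
Local Notation nu := (edge_measure P mV V01).
Local Notation e A B := (rmeasure nu (A `*` B)).
Local Notation cut A := (e A (~` A)).

Definition nbhd eps A : set T := [set x | (eps <= kappa A x)%R].

Definition reach eps n A : set T := \bigcup_(k in `I_n.+1) iter k (nbhd eps) A.

Let p_negligible A : measurable A -> P.-negligible A -> p A = 0%R.
Proof.
by move=> mA /(negligibleP _ mA) A0; rewrite /rmeasure A0.
Qed.

Lemma measurable_nbhd eps A : measurable A -> measurable (nbhd eps A).
Proof.
move=> mA; rewrite /nbhd.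
have := measurable_kappa P mV V01 mA measurableT (measurable_itv `[eps, +oo[).
rewrite setTI; congr measurable; apply/seteqP; split => x /=;
  by rewrite in_itv/= andbT.
Qed.

Lemma measurable_iter_nbhd eps k A : measurable A ->
  measurable (iter k (nbhd eps) A).
Proof. by move=> mA; elim: k => //= k; exact: measurable_nbhd. Qed.

Lemma measurable_reach eps n A : measurable A -> measurable (reach eps n A).
Proof.
by move=> mA; apply: bigcup_measurable => k _; exact: measurable_iter_nbhd.
Qed.

Lemma subset_reach eps n A : A `<=` reach eps n A.
Proof. by move=> x Ax; exists 0%N. Qed.

Lemma reach_nd eps n m A : (n <= m)%N -> reach eps n A `<=` reach eps m A.
Proof.
by move=> nm x [k /= kn kx]; exists k => //=; exact: leq_trans nm.
Qed.

Lemma nbhd_mono eps eps' A B : measurable A -> measurable B ->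
  (eps' <= eps)%R -> A `<=` B -> nbhd eps A `<=` nbhd eps' B.
Proof.
move=> mA mB le_eps AB x; rewrite /nbhd/= => /(le_trans le_eps) /le_trans; apply.
exact: le_rmeasure.
Qed.

Lemma iter_nbhd_mono eps eps' k A B : measurable A -> measurable B ->
  (eps' <= eps)%R -> A `<=` B ->
  iter k (nbhd eps) A `<=` iter k (nbhd eps') B.
Proof.
move=> mA mB le_eps AB; elim: k => //= k IH.
by apply: nbhd_mono => //; exact: measurable_iter_nbhd.
Qed.

(** An unreached point receives less than [eps] from each of the [n.+1] layers that make up
    [reach eps n A]. *)
Lemma kappa_reach_le eps n A x : measurable A -> ~ reach eps n.+1 A x ->
  (kappa (reach eps n A) x <= n.+1%:R * eps)%R.
Proof.
move=> mA nx; apply: rmeasure_bigcup_le => k; first exact: measurable_iter_nbhd.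
move=> kn; rewrite leNgt; apply/negP => /ltW h; apply: nx.
by exists k.+1.
Qed.

Lemma edge_le_kappa A B (r : R) : measurable A -> measurable B -> (0 <= r)%R ->
  (forall x, B x -> (kappa A x <= r)%R) -> (e A B <= r * p B)%R.
Proof.
move=> mA mB r0 h; rewrite -lee_fin edgeE// EFinM rmeasureE// -integral_cst//.
apply: ge0_le_integral => //.
- by move=> x _; rewrite lee_fin rmeasure_ge0.
- by apply/measurable_EFinP/measurable_funTS/measurable_kappa.
Qed.

Lemma edge_ge_kappa A B (r : R) : measurable A -> measurable B -> (0 <= r)%R ->
  (forall x, B x -> (r <= kappa A x)%R) -> (r * p B <= e A B)%R.
Proof.
move=> mA mB r0 h; rewrite -lee_fin edgeE// EFinM rmeasureE// -integral_cst//.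
apply: ge0_le_integral => //.
- by apply/measurable_EFinP/measurable_funTS/measurable_kappa.
Qed.

(** A point outside [A] can only enter at a positive step, where it receives at least [eps] from a
    layer and so has degree at least [eps]. *)
Lemma reach_low_degree eps n A : measurable A -> p (reach eps n A) = 1%R ->
  P.-negligible ([set x | (kappa setT x < eps)%R] `\` A).
Proof.
move=> mA p1; have mU := measurable_reach eps n mA.
apply: (@negligibleS _ _ _ _ (~` reach eps n A)).
  move=> x [/= degx nAx] [[|k] /= _] //=; rewrite /nbhd/= leNgt => /negP; apply.
  apply: le_lt_trans degx; apply: le_rmeasure => //.
  exact: measurable_iter_nbhd.
apply/negligibleP; first exact: measurableC.
by rewrite -[LHS](rmeasureE P (measurableC mU)) rprobability_setC// p1 subrr.
Qed.

Lemma reach_invariant eps n A : measurable A -> (0 < eps)%R -> cut A = 0%R ->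
  (p (reach eps n A) <= p A)%R.
Proof.
move=> mA eps0 cA0; have mA' := measurableC mA.
(* Such a [B] accounts for at least [eps * p B] of the cut of [A], which is zero. *)
have p0 B : measurable B -> B `<=` ~` A -> (forall x, B x -> (eps <= kappa A x)%R) ->
    p B = 0%R.
  move=> mB BA hB; apply/eqP; rewrite eq_le rmeasure_ge0 andbT.
  have : (eps * p B <= 0)%R.
    rewrite -cA0; apply: (le_trans (edge_ge_kappa mA mB (ltW eps0) hB)).
    apply: le_rmeasure; try exact: measurableX.
    by move=> [x y] /= [Ax By]; split => //; exact: BA.
  by rewrite pmulr_rle0.
have iter0 k : p (iter k (nbhd eps) A `\` A) = 0%R.
  elim: k => [|k IH] /=; first by rewrite setDv /rmeasure measure0.
  have mC := measurable_iter_nbhd eps k mA; set C := iter k _ A in IH mC *.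
  apply: p0 => [|x []//|x [/= Cx nAx]].
    by apply: measurableD => //; exact: measurable_nbhd.
  (* By induction the layer [C] lies in [A] up to a null set, so what [x] receives from [C] it
     receives from [A]. *)
  apply: (le_trans Cx).
  have := rmeasureID (kappa_measure P mV V01 x) mC mA.
  have : (kappa (C `&` A) x <= kappa A x)%R.
    by apply: le_rmeasure => //; exact: measurableI.
  have := kappa_le P mV V01 x (measurableD mC mA).
  by rewrite IH; lra.
have mU := measurable_reach eps n mA.
rewrite (rmeasureID P mU mA).
have : (p (reach eps n A `&` A) <= p A)%R.
  by apply: le_rmeasure => //; exact: measurableI.
have -> : reach eps n A `\` A = \bigcup_(k in `I_n.+1) (iter k (nbhd eps) A `\` A).
  by rewrite -setD_bigcupl.
have : (p (\bigcup_(k in `I_n.+1) (iter k (nbhd eps) A `\` A)) <= n.+1%:R * 0)%R.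
  apply: rmeasure_bigcup_le => k; last by rewrite iter0.
  by apply: measurableD => //; exact: measurable_iter_nbhd.
by rewrite mulr0; lra.
Qed.

(** Whichever of [A] and its complement has measure at least 1/2 reaches almost everything, yet with
    cut 0 it gains no measure by reaching. *)
Lemma reach_half_connected :
  (forall A, measurable A -> (2^-1 <= p A)%R -> exists n eps,
     (0 < eps)%R /\ p (reach eps n A) = 1%R) ->
  forall A, measurable A -> cut A = 0%R -> p A = 0%R \/ p A = 1%R.
Proof.
move=> H A mA cA0; have mA' := measurableC mA.
have aux B : measurable B -> cut B = 0%R -> (2^-1 <= p B)%R -> p B = 1%R.
  move=> mB cB pB; have [n [eps [eps0 p1]]] := H _ mB pB.
  have := reach_invariant n mB eps0 cB; rewrite p1 => h.
  by apply/eqP; rewrite eq_le h rprobability_le1.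
have [h|h] := leP (2^-1)%R (p A); first by right; exact: aux.
left; have := aux _ mA'.
rewrite (cutC P mV V01 Vsym mA) rprobability_setC// => /(_ cA0).
have h' : (2^-1 <= 1 - p A)%R by lra.
by move=> /(_ h'); lra.
Qed.

(** Measure exactly 1/2 lets the hypothesis apply to [H] and to its complement; each of them bounds
    the degrees on the other. *)
Lemma reach_half_degree H : measurable H -> p H = (2^-1)%R ->
  (forall A, measurable A -> (2^-1 <= p A)%R -> exists n eps,
     (0 < eps)%R /\ p (reach eps n A) = 1%R) ->
  exists2 delta : R, (0 < delta)%R & {ae P, forall x, (delta <= kappa setT x)%R}.
Proof.
move=> mH pH hyp; have mH' := measurableC mH.
have [|n [e1 [e10 p1]]] := hyp _ mH; first by rewrite pH.
have [|m [e2 [e20 p2]]] := hyp _ mH'; first by rewrite rprobability_setC// pH; lra.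
exists (Num.min e1 e2); first by rewrite lt_min e10.
apply: negligibleS (negligibleU (reach_low_degree mH p1) (reach_low_degree mH' p2)).
move=> x /= /negP; rewrite -ltNge lt_min => /andP[h1 h2].
by have [Hx|Hx] := pselect (H x); [right|left]; split => // /(_ Hx).
Qed.

(** * Expansion from a degree bound and connectedness *)

Section min_degree.
Context (delta : R) (delta0 : (0 < delta)%R).
Context (deg_ge : {ae P, forall x, (delta <= kappa setT x)%R}).
Context (connected : forall A, measurable A -> cut A = 0%R ->
  p A = 0%R \/ p A = 1%R).

Lemma reach_large_uniform : exists n eps, (0 < eps)%R /\
  forall A, measurable A -> (delta / 2 <= p A)%R -> p (reach eps n A) = 1%R.
Proof.
have [beta beta0 hbeta] := cut_lower_bound Vsym delta0 deg_ge connected.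
(* [beta] drives the growth and [delta] the last step. [M] exceeds [2 / c], so that [M] gains of
   [c / 2] would surpass the total mass 1, and [eps] is such that [M.+1] layers together send an
   unreached point at most [c / 2]. *)
pose c := Num.min beta delta.
have c0 : (0 < c)%R by rewrite lt_min beta0.
have cb : (c <= beta)%R by rewrite ge_min lexx.
have cd : (c <= delta)%R by rewrite ge_min lexx orbT.
pose M := (Num.truncn (2 / c)).+1.
pose eps := (c / 2 / M.+1%:R)%R.
have M0 : (0 < M.+1%:R :> R)%R by rewrite ltr0n.
have eps0 : (0 < eps)%R by rewrite !divr_gt0.
have epsj j : (j <= M)%N -> (j.+1%:R * eps <= c / 2)%R.
  move=> jM; rewrite /eps mulrC -[leLHS]mulrA; apply: ler_piMr; first by lra.
  by rewrite mulrC ler_pdivrMr// mul1r ler_nat.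
have Mc : (1 < M%:R * (c / 2))%R.
  have : (2 / c < M%:R)%R by exact: truncnS_gt.
  by rewrite ltr_pdivrMr//; lra.
exists M.+1, eps; split => // A mA pA.
pose U j := reach eps j A.
have mU j : measurable (U j) by exact: measurable_reach.
have mU' j : measurable (~` U j) by exact: measurableC.
have Ule j : (p (U j) <= p (U j.+1))%R by apply: le_rmeasure => //; exact: reach_nd.
have kU j x : (j <= M)%N -> ~ U j.+1 x -> (kappa (U j) x <= c / 2)%R.
  by move=> jM nx; apply: le_trans (epsj j jM); exact: kappa_reach_le.
have grow j : (j <= M)%N ->
    (1 - delta / 2 < p (U j))%R \/ (j%:R * (c / 2) <= p (U j))%R.
  elim: j => [|j IH] jM; first by right; rewrite mul0r rmeasure_ge0.
  have [h|h] := IH (ltnW jM); first by left; exact: lt_le_trans (Ule j).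
  have [pUj|pUj] := ltP (1 - delta / 2)%R (p (U j)).
    by left; exact: lt_le_trans (Ule j).
  (* Of the cut of [U j], which is at least [c], at most [c / 2] goes to points still unreached at
     the next step. The rest goes to the newly reached points, whose measure is therefore at least
     [c / 2]. *)
  right; have mD : measurable (~` U j `\` U j.+1) by exact: measurableD.
  have mI : measurable (~` U j `&` U j.+1) by exact: measurableI.
  have : (beta <= cut (U j))%R.
    apply: hbeta => //; apply: (le_trans pA); apply: le_rmeasure => //.
    exact: subset_reach.
  have : (e (U j) (~` U j `\` U j.+1) <= c / 2 * p (~` U j `\` U j.+1))%R.
    apply: edge_le_kappa => //; first by rewrite divr_ge0// ltW.
    by move=> x [_ nx]; apply: kU => //; exact: ltnW.
  have : (c / 2 * p (~` U j `\` U j.+1) <= c / 2)%R.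
    by rewrite ler_piMr ?rprobability_le1// divr_ge0// ltW.
  have : (p (U j) * p (~` U j `&` U j.+1) <= p (~` U j `&` U j.+1))%R.
    by rewrite ler_piMl ?rprobability_le1// rmeasure_ge0.
  have := edge_split P mV V01 (mU j) (mU' j) (mU j.+1).
  have := edge_le P mV V01 (mU j) mI.
  have := rmeasureID P (mU j.+1) (mU j).
  have -> : U j.+1 `\` U j = ~` U j `&` U j.+1 by rewrite setDE setIC.
  have -> : U j.+1 `&` U j = U j by exact: setIidr (reach_nd (leqnSn j)).
  by rewrite -(natr1 j); lra.
have pUM : (1 - delta / 2 < p (U M))%R.
  have [//|h] := grow M (leqnn M).
  by have := rprobability_le1 P (mU M); lra.
(* An unreached point receives at most [c / 2 <= delta / 2] from [U M] and less than [delta / 2]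
   from the complement, so its degree is below [delta]. *)
have : p (~` U M.+1) = 0%R.
  apply: p_negligible => //; apply: negligibleS deg_ge => x nUx /= dx.
  have := kU M x (leqnn M) nUx.
  have := rmeasureID (kappa_measure P mV V01 x) measurableT (mU M).
  have := kappa_le P mV V01 x (mU' M).
  by rewrite setTI setTD rprobability_setC//; lra.
by rewrite rprobability_setC//; lra.
Qed.

Lemma reach_positive : exists n, forall A, measurable A -> (0 < p A)%R ->
  exists2 eps, (0 < eps)%R & p (reach eps n A) = 1%R.
Proof.
have [n [e0 [e00 H]]] := reach_large_uniform.
(* [A] sends out at least [delta * p A], of which at most [eA], half of it, lands outside [B]. So
   [B] receives at least [eA]; as it receives at most [p A * p B], its measure is at least
   [delta / 2]. *)
exists n.+1 => A mA pA; pose eA := (delta * p A / 2)%R.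
have eA0 : (0 < eA)%R by rewrite divr_gt0// mulr_gt0.
pose B := nbhd eA A; have mB : measurable B by exact: measurable_nbhd.
have mB' := measurableC mB; have mA' := measurableC mA.
have pB : (delta / 2 <= p B)%R.
  have : (e A (~` B) <= eA * p (~` B))%R.
    apply: edge_le_kappa => //; first exact: ltW.
    by move=> x /negP; rewrite -ltNge => /ltW.
  have : (eA * p (~` B) <= eA)%R by rewrite ler_piMr ?rprobability_le1// ltW.
  have := edge_split P mV V01 mA measurableT mB; rewrite setTI setTD.
  have := edge_le P mV V01 mA mB.
  have := mass_degree_le Vsym delta0 deg_ge mA.
  by rewrite /eA => h1 h2 h3 h4 h5; rewrite -(ler_pM2l pA); lra.
(* The smaller threshold serves both the first step, from [A] onto [B], and the iteration from [B],
   which then appears shifted by one step. *)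
pose eps := Num.min eA e0.
have eps0 : (0 < eps)%R by rewrite lt_min eA0.
exists eps => //; apply/eqP; rewrite eq_le.
rewrite rprobability_le1/=; last exact: measurable_reach.
rewrite -(H B mB pB); apply: le_rmeasure; try exact: measurable_reach.
move=> x [k /= kn kx]; exists k.+1 => //; rewrite iterSr.
have mB2 : measurable (nbhd eps A) by exact: measurable_nbhd.
have BB2 : B `<=` nbhd eps A by apply: nbhd_mono => //; rewrite ge_min lexx.
by apply: iter_nbhd_mono kx => //; rewrite ge_min lexx orbT.
Qed.

End min_degree.
End expansion.

(** * Null sets of completed measures *)

Section measurable_hull.
Context d (T : measurableType d) (R : realType).
Context (m : {measure set T -> \bar R}).

(** Intersect countable measurable covers of [E] whose total measures exceed its outer measure by at
    most [n.+1%:R^-1]. *)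
Lemma measurable_hull_exists (E : set T) : (m^*)%mu E < +oo ->
  exists F, [/\ measurable F, E `<=` F & m F = (m^*)%mu E].
Proof.
move=> Eoo; have E0 : 0 <= (m^*)%mu E by exact: outer_measure_ge0.
have Efin : (m^*)%mu E \is a fin_num by rewrite ge0_fin_numE.
have cover (n : nat) : exists A, @measurable_cover _ T E A /\
    \sum_(k <oo) m (A k) <= (m^*)%mu E + (n.+1%:R^-1)%:E.
  have n0 : (0 < n.+1%:R^-1 :> R)%R by rewrite invr_gt0.
  have [_ [A EA <-] /ltW h] := lb_ereal_inf_adherent n0 Efin.
  by exists A.
have [A hA] := choice cover.
have mA n k : measurable (A n k) by have [[]] := hA n.
pose F := \bigcap_n \bigcup_k A n k.
have mF : measurable F by apply: bigcapT_measurable => n; exact: bigcupT_measurable.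
have EF : E `<=` F by move=> x Ex n _; have [[_ EA] _] := hA n; exact: EA.
exists F; split => //; apply/eqP; rewrite eq_le; apply/andP; split; last first.
  by rewrite -(measurable_mu_extE m mF); exact: le_outer_measure.
apply/lee_addgt0Pr => eps eps0; near \oo => n.
have [_ h] := hA n.
apply: (@le_trans _ _ ((m^*)%mu E + (n.+1%:R^-1)%:E)); last first.
  rewrite leeD2l// lee_fin ltW//.
  by near: n; exact: near_infty_natSinv_lt (PosNum eps0).
apply: le_trans h; apply: (@le_trans _ _ (m (\bigcup_k A n k))).
  apply: le_measure; rewrite ?inE//; first exact: bigcupT_measurable.
  exact: bigcap_inf.
by apply: measure_sigma_subadditive => //; exact: bigcupT_measurable.
Unshelve. all: by end_near. Qed.

(** Caratheodory's condition for [E], tested on a hull [F] of the same finite measure, shows that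
    [F] minus [E] has outer measure 0; [N] is a hull of this difference. *)
Lemma caratheodory_approx (D E : set T) : measurable D -> m D < +oo ->
  (measurable (E : set (caratheodory_type (m^*)%mu))) -> E `<=` D ->
  exists F N, [/\ measurable F, measurable N, m N = 0, E `<=` F & F `\` E `<=` N].
Proof.
move=> mD Doo mE ED.
have EDle : (m^*)%mu E <= m D.
  by rewrite -(measurable_mu_extE m mD); exact: le_outer_measure.
have [F [mF EF mFE]] := measurable_hull_exists (le_lt_trans EDle Doo).
have Efin : (m^*)%mu E \is a fin_num.
  by rewrite ge0_fin_numE; [exact: le_lt_trans Doo|exact: outer_measure_ge0].
have FE0 : (m^*)%mu (F `\` E) = 0.
  have hF : (m^*)%mu F = (m^*)%mu E by rewrite (measurable_mu_extE m mF).
  have h : (m^*)%mu E = (m^*)%mu E + (m^*)%mu (F `\` E).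
    have h0 : (m^*)%mu F = (m^*)%mu (F `&` E) + (m^*)%mu (F `&` ~` E) := mE F.
    by rewrite (setIidr EF) -setDE hF in h0.
  have : (m^*)%mu E + (m^*)%mu (F `\` E) = (m^*)%mu E + 0.
    by rewrite adde0 -h.
  move/(congr1 (fun x => x - (m^*)%mu E)).
  by rewrite addeAC subee// add0e addeAC subee// add0e.
have [|N [mN FEN mN0]] := @measurable_hull_exists (F `\` E); first by rewrite FE0 ltry.
by exists F, N; split => //; rewrite mN0.
Qed.

Lemma outer_null_hull (E : set T) : (m^*)%mu E = 0 ->
  exists2 F, measurable F & E `<=` F /\ m F = 0.
Proof.
move=> E0; have [|F [mF EF]] := @measurable_hull_exists E; first by rewrite E0 ltry.
by rewrite E0 => mF0; exists F.
Qed.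

End measurable_hull.

Section null_sections.
Context d (T : measurableType d) (R : realType).
Context (m : {sigma_finite_measure set T -> \bar R}).
Implicit Types E : set (T * T).

Let integral0 (f : T -> \bar R) : measurable_fun setT f -> (forall x, 0 <= f x) ->
  \int[m]_x f x = 0 <-> {ae m, forall x, f x = 0}.
Proof.
move=> mf f0.
have -> : \int[m]_x f x = \int[m]_x `|f x|.
  by apply: eq_integral => x _; rewrite gee0_abs.
rewrite ae_eq_integral_abs//; split => h; apply: filterS h => x; last by move=> ->.
exact.
Qed.

Lemma product_null_xsection E : measurable E ->
  (m \x m) E = 0 <-> {ae m, forall x, m (xsection E x) = 0}.
Proof. by move=> mE; apply: integral0 => //; exact: measurable_fun_xsection. Qed.

Lemma product_null_ysection E : measurable E ->
  (m \x m) E = 0 <-> {ae m, forall x, m (ysection E x) = 0}.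
Proof.
move=> mE.
have -> : (m \x m) E = (m \x^ m) E.
  by apply: product_measure_unique => // A B mA mB; rewrite /= product_measure2E.
by apply: integral0 => //; exact: measurable_fun_ysection.
Qed.

End null_sections.

Section almost_everywhere.
Context d (T : measurableType d) (R : realType) (m : {measure set T -> \bar R}).
Implicit Types Q : T -> Prop.

Lemma aeW Q : (forall x, Q x) -> {ae m, forall x, Q x}.
Proof. by move=> h; apply: negligibleS (negligible_set0 m) => x; apply. Qed.

Lemma ae_mono Q Q' : (forall x, Q x -> Q' x) ->
  {ae m, forall x, Q x} -> {ae m, forall x, Q' x}.
Proof. by move=> QQ'; apply: negligibleS => x /= nQ' /QQ'. Qed.

Lemma ae_mono2 Q Q' Q'' : (forall x, Q x -> Q' x -> Q'' x) ->
  {ae m, forall x, Q x} -> {ae m, forall x, Q' x} -> {ae m, forall x, Q'' x}.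
Proof.
move=> h hQ hQ'; apply: negligibleS (negligibleU hQ hQ') => x /= nQ''.
by apply: contrapT => /not_orP[/contrapT Qx /contrapT Q'x]; apply: nQ''; exact: h.
Qed.

Lemma ae_eq_measure (A B : set T) : measurable A -> measurable B ->
  {ae m, forall x, A x <-> B x} -> m A = m B.
Proof.
have aux (C D : set T) : measurable C -> measurable D ->
    {ae m, forall x, C x <-> D x} -> m C <= m D.
  move=> mC mD [Z [mZ Z0 sZ]]; rewrite -[leRHS]adde0 -[X in _ + X]Z0.
  apply: le_trans (measureU2 _ _ _) => //.
  apply: le_measure; rewrite ?inE//; first exact: measurableU.
  move=> x Cx; have [Zx|Zx] := pselect (Z x); [by right|left].
  apply: contrapT => nDx; apply: Zx; apply: sZ => /= -[+ _].
  by apply: contra_not nDx; exact.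
move=> mA mB AB; apply/eqP; rewrite eq_le !aux//.
by apply: ae_mono AB => x [? ?]; split.
Qed.

End almost_everywhere.

Section complete_measure.
Context d (T : measurableType d) (R : realType) (m : {measure set T -> \bar R}).
Context (cm : measure_is_complete m).

(** Off a null set [A] coincides with the intersection of [D] and [B]; inside the null set
    completeness makes it measurable. *)
Lemma complete_ae_measurable (A B D : set T) : measurable D -> measurable B ->
  A `<=` D -> {ae m, forall x, D x -> (A x <-> B x)} -> measurable A.
Proof.
move=> mD mB AD [N [mN N0 sN]].
have -> : A = ((D `&` B) `\` N) `|` (A `&` N).
  apply/seteqP; split => x /=.
    move=> Ax; have [Nx|Nx] := pselect (N x); first by right.
    have Dx := AD _ Ax.
    have AB : A x <-> B x by apply: contrapT => h; apply: Nx; apply: sN => /= /(_ Dx).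
    by left; split => //; split => //; exact/AB.
  move=> [[[Dx Bx] Nx]|[]//].
  have AB : A x <-> B x by apply: contrapT => h; apply: Nx; apply: sN => /= /(_ Dx).
  exact/AB.
apply: measurableU; first by apply: measurableD => //; exact: measurableI.
by apply: cm; exists N; split => // x [].
Qed.

Lemma complete_ae_measurable_fun d' (T' : measurableType d') (D : set T)
    (f g : T -> T') : measurable D -> measurable_fun D g ->
  {ae m, forall x, D x -> f x = g x} -> measurable_fun D f.
Proof.
move=> mD mg fg _ Y mY.
apply: (@complete_ae_measurable _ (D `&` g @^-1` Y) D) => //.
  exact: mg.
apply: filterS fg => x fg Dx /=; rewrite fg//.
Qed.

End complete_measure.

(** * The unit interval as a probability space, and a Borel version of a graphon *)

Section unit_interval.
Context (R : realType).
Local Notation lambda := (@completed_lebesgue_measure R).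
Local Notation leb := (@lebesgue_measure R).
Local Notation borel := (measurableTypeR R).
Local Notation line := (lebesgue_line R).
Local Notation I := (@unit_interval R).

Lemma measurable_line (A : set R) :
  measurable (A : set borel) -> measurable (A : set line).
Proof. exact: sub_caratheodory. Qed.

Lemma measurable_unit_borel : measurable (I : set borel).
Proof. exact: measurable_itv. Qed.

Lemma measurable_unit : measurable (I : set line).
Proof. by apply: measurable_line; exact: measurable_unit_borel. Qed.

Lemma lebesgue_unit : leb I = 1.
Proof.
by rewrite /unit_interval lebesgue_measure_itv/= lte_fin ltr01 -EFinB subr0.
Qed.

Lemma lambda_unit : lambda I = 1.
Proof. exact: lebesgue_unit. Qed.

(** The restriction is kept as a measure on the whole line, with the outside of [0, 1] null, so that
    no subtype is involved. *)
Definition unit_prob : set line -> \bar R := mrestr lambda measurable_unit.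

HB.instance Definition _ := Measure.on unit_prob.

Let unit_probT : unit_prob setT = 1.
Proof. by rewrite /unit_prob /mrestr setTI lambda_unit. Qed.

HB.instance Definition _ := Measure_isProbability.Build _ _ _ unit_prob unit_probT.

Lemma unit_probE (A : set R) : A `<=` I -> unit_prob A = lambda A.
Proof. by move=> AI; rewrite /unit_prob /mrestr setIidl. Qed.

Lemma ae_unit_prob (Q : R -> Prop) :
  {ae lambda, forall x, I x -> Q x} -> {ae unit_prob, forall x, Q x}.
Proof.
move=> [N [mN N0 sN]].
exists (N `|` ~` I); split => /=.
- by apply: measurableU => //; apply: measurableC; exact: measurable_unit.
- rewrite /unit_prob /mrestr setIUl setICl setU0.
  apply: (subset_measure0 _ _ _ N0) => //.
  by apply: measurableI => //; exact: measurable_unit.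
- move=> x /= nQ; have [Ix|nIx] := pselect (I x); [left|by right].
  by apply: sN => /= h; apply: nQ; exact: h.
Qed.

Lemma ae_lambda (Q : R -> Prop) :
  {ae unit_prob, forall x, Q x} -> {ae lambda, forall x, I x -> Q x}.
Proof.
move=> [N [mN N0 sN]].
exists (N `&` I); split => //.
  by apply: measurableI => //; exact: measurable_unit.
by move=> x /= /not_implyP[Ix nQ]; split => //; exact: sN.
Qed.

Lemma measurable_fun_line2 (f : R * R -> R) :
  measurable_fun setT (f : borel * borel -> R) ->
  measurable_fun setT (f : line * line -> R).
Proof.
move=> mf.
have mid : measurable_fun setT (id : line -> borel).
  by move=> _ A mA; rewrite setTI preimage_id; exact: measurable_line.
have mpair : measurable_fun setT (fun z : line * line => (z.1 : borel, z.2 : borel)).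
  apply: measurable_fun_pair.
  - exact: (measurableT_comp mid measurable_fst).
  - exact: (measurableT_comp mid measurable_snd).
by have := measurableT_comp mf mpair; apply: eq_measurable_fun => -[].
Qed.

Lemma rat_seq_dense : exists r : R^nat, forall a b : R, (a < b)%R ->
  exists n, (a < r n < b)%R.
Proof.
exists (fun n => ratr (odflt (0%R : rat) (unpickle n))) => a b ab.
have [q] := rat_in_itvoo ab; rewrite in_itv/= => qab.
by exists (pickle q); rewrite pickleK.
Qed.

(** The set where [W] exceeds [r n] has a Borel hull [F n] that differs from it only within a null
    set [N n]; the [N n] are discarded together. *)
Lemma graphon_borel (W : graphon R) : exists N : set (borel * borel),
  [/\ measurable N, (leb \x leb) N = 0 &
      measurable_fun ((I `*` I) `\` N) (fun z : borel * borel => W z.1 z.2)].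
Proof.
have [r hr] := rat_seq_dense.
have mII : measurable (I `*` I : set (borel * borel)).
  by apply: measurableX; exact: measurable_unit_borel.
have mII2 : measurable (I `*` I : set (lebesgue_plane R)).
  by apply: sub_caratheodory; exact: sub_sigma_algebra.
have IIoo : (leb \x leb) (I `*` I) < +oo.
  rewrite product_measure1E; try exact: measurable_unit_borel.
  rewrite [X in X < _](_ : _ = 1) ?ltry// -[RHS]mule1.
  by congr (_ * _); exact: lebesgue_unit.
pose E n := (I `*` I) `&` [set z | (r n < W z.1 z.2)%R].
have mE n : measurable (E n : set (lebesgue_plane R)).
  have := graphon_measurable W mII2 (measurable_itv `]r n, +oo[).
  congr measurable; apply/seteqP; split => z /= [Iz];
    by rewrite in_itv/= andbT => h; split.
have [F hF] := choice (fun n =>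
  caratheodory_approx mII IIoo (mE n) (@subIsetl _ _ _)).
have [N hN] := choice hF.
have mN n : measurable (N n) by have [] := hN n.
exists (\bigcup_n N n); split.
- exact: bigcupT_measurable.
- apply/negligibleP; first exact: bigcupT_measurable.
  by apply: negligible_bigcup => n; apply/negligibleP => //; have [] := hN n.
- set S := _ `\` _.
  have mS : measurable S by apply: measurableD => //; exact: bigcupT_measurable.
  apply: (measurability _ (RGenOInfty.measurableE R)) => //.
  move=> /= _ [_ [a ->] <-].
  (* A value exceeds [a] exactly when it exceeds some [r n > a], and on [S] the latter means
     membership in [F n]. *)
  have -> : S `&` (fun z : borel * borel => W z.1 z.2) @^-1` `]a, +oo[ =
      \bigcup_n (if (a < r n)%R then S `&` F n else set0).
    apply/seteqP; split => z /=.
      move=> [Sz]; rewrite in_itv/= andbT => /hr[n /andP[an nW]].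
      exists n => //; rewrite an; split => //.
      by have [_ _ _ + _] := hN n; apply; split => //; case: Sz.
    move=> [n _]; case: ifPn => // an [Sz Fz]; split => //.
    rewrite in_itv/= andbT; apply: (lt_trans an).
    have [_ _ _ _ FN] := hN n; apply: contrapT => nE; case: (Sz) => _; apply.
    by exists n => //; apply: FN; split => // -[].
  apply: bigcupT_measurable => n; case: ifPn => // _.
  by apply: measurableI => //; have [] := hN n.
Qed.

End unit_interval.

(** * From graphons to measurable kernels *)

Section transfer.
Context (R : realType) (W : graphon R).
Local Notation lambda := (@completed_lebesgue_measure R).
Local Notation lambda2 := (@completed_lebesgue_measure2 R).
Local Notation leb := (@lebesgue_measure R).
Local Notation borel := (measurableTypeR R).
Local Notation line := (lebesgue_line R).
Local Notation I := (@unit_interval R).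
Local Notation P := (@unit_prob R).

Context (N : set (borel * borel)) (mN : measurable N) (N0 : (leb \x leb) N = 0).
Context (mW : measurable_fun ((I `*` I) `\` N)
                (fun z : borel * borel => W z.1 z.2)).

Let Ns : set (borel * borel) := [set z | N (z.2, z.1)].

Let mNs : measurable Ns.
Proof.
have := @measurable_swap _ _ borel borel measurableT _ mN.
by rewrite setTI.
Qed.

Let S : set (borel * borel) := (I `*` I) `\` (N `|` Ns).

Let mS : measurable S.
Proof.
apply: measurableD; last exact: measurableU.
by apply: measurableX; exact: measurable_unit_borel.
Qed.

(* Discarding the null set [N] makes [W] Borel; discarding its transpose [Ns] as
   well keeps it symmetric. *)
Definition sym_kernel (x y : R) : R :=
  ((fun z : borel * borel => W z.1 z.2) \_ S) (x, y).
Local Notation V := sym_kernel.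

Let VE x y : S (x, y) -> V x y = W x y.
Proof. by move=> Sxy; rewrite /V patchE mem_set. Qed.

Let VN x y : ~ S (x, y) -> V x y = 0%R.
Proof. by move=> Sxy; rewrite /V patchE memNset. Qed.

Let S_sym x y : S (x, y) -> S (y, x).
Proof.
rewrite /S /Ns => -[[/= Ix Iy] nN]; split => // -[h|h]; apply: nN; by [right|left].
Qed.

Lemma sym_kernel_sym x y : V x y = V y x.
Proof.
have [Sxy|Sxy] := pselect (S (x, y)).
  rewrite VE// VE; last exact: S_sym.
  by case: Sxy => -[/= Ix Iy] _; exact: graphon_sym.
by rewrite VN// VN// => /S_sym.
Qed.

Lemma sym_kernel01 x y : (0 <= V x y <= 1)%R.
Proof.
have [Sxy|Sxy] := pselect (S (x, y)); last by rewrite VN// lexx ler01.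
by rewrite VE//; case: Sxy => -[/= Ix Iy] _; exact: graphon_range.
Qed.

Let mV_borel : measurable_fun setT (fun z : borel * borel => V z.1 z.2).
Proof.
have : measurable_fun S (fun z : borel * borel => W z.1 z.2).
  apply: measurable_funS mW; first apply: measurableD => //.
    by apply: measurableX; exact: measurable_unit_borel.
  by move=> z [Iz nz]; split => // Nz; apply: nz; left.
by move/(measurable_restrictT _ mS); apply: eq_measurable_fun => -[].
Qed.

Lemma measurable_sym_kernel : measurable_fun setT (fun z : line * line => V z.1 z.2).
Proof. exact: (measurable_fun_line2 mV_borel). Qed.

Local Notation mV := measurable_sym_kernel.
Local Notation V01 := sym_kernel01.
Local Notation p := (rmeasure P).
Local Notation kappa A x := (rmeasure (kappa_measure P mV V01 x) A).
Local Notation nu := (edge_measure P mV V01).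
Local Notation e A B := (rmeasure nu (A `*` B)).
Local Notation cut A := (e A (~` A)).
Local Notation nbhd := (nbhd P mV V01).
Local Notation reach := (reach P mV V01).

Let ae_borel (Q : R -> Prop) : {ae leb, forall x, Q x} -> {ae lambda, forall x, Q x}.
Proof.
by move=> [A [mA A0 sA]]; exists A; split => //; exact: measurable_line.
Qed.

(* Off these [y] the section of [W] at [y] may fail to be measurable. *)
Let good y := lambda (xsection N y) = 0 /\ lambda (ysection N y) = 0.

Let ae_good : {ae lambda, forall y, good y}.
Proof.
have /ae_borel hx := (product_null_xsection leb mN).1 N0.
have /ae_borel hy := (product_null_ysection leb mN).1 N0.
by apply: (ae_mono2 _ hx hy) => y; split.
Qed.

Let WV y : good y -> I y -> {ae lambda, forall x, I x -> W x y = V x y}.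
Proof.
move=> [Nx Ny] Iy.
(* These sections hold the [x] for which [(x, y)] lies in the transpose [Ns] or in [N]. *)
exists (xsection N y `|` ysection N y); split.
- apply: measurable_line; apply: measurableU.
    exact: measurable_xsection.
  exact: measurable_ysection.
- have mx : measurable (xsection N y : set line).
    by apply: measurable_line; exact: measurable_xsection.
  have my : measurable (ysection N y : set line).
    by apply: measurable_line; exact: measurable_ysection.
  apply/negligibleP; first exact: measurableU.
  by apply: negligibleU; exact/negligibleP.
- move=> x /= /not_implyP[Ix WxV].
  have nS : ~ S (x, y) by move=> Sxy; apply: WxV; rewrite VE.
  rewrite /xsection /ysection /= !in_setE; apply: contrapT => /not_orP[h1 h2].
  by apply: nS; split => // -[].
Qed.

(** First [W] is replaced by [V], equal to it almost everywhere, with completeness making the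
    section of [W] measurable; then [lambda] by [P], which agree on subsets of [A]. *)
Lemma graphon_integral A y : unit_measurable A -> good y -> I y ->
  \int[lambda]_(x in (A : set line)) (W x y)%:E = (kappa A y)%:E.
Proof.
move=> [AI mA] gy Iy.
have mVA : measurable_fun (A : set line) (V ^~ y).
  apply: measurable_funTS.
  have := measurableT_comp mV (pair2_measurable (y : line)).
  by apply: eq_measurable_fun.
have aeA : {ae lambda, forall x, A x -> W x y = V x y}.
  by apply: ae_mono (WV gy Iy) => x h Ax; apply: h; exact: AI.
rewrite (kappaE P mV V01 y mA).
transitivity (\int[lambda]_(x in (A : set line)) (V x y)%:E).
  apply: ae_eq_integral.
  - exact: mA.
  - apply/measurable_EFinP.
    apply: complete_ae_measurable_fun mA mVA aeA.
    exact: completed_lebesgue_measure_is_complete.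
  - exact/measurable_EFinP.
  - by apply: ae_mono aeA => x h Ax; rewrite h.
apply: eq_measure_integral => B mB BA.
by rewrite /= unit_probE//; exact: subset_trans AI.
Qed.

Let kappa_ae A B x : measurable (A : set line) -> measurable (B : set line) ->
  {ae lambda, forall x, I x -> (A x <-> B x)} -> kappa A x = kappa B x.
Proof.
move=> mA mB /ae_unit_prob AB.
have aux (C D : set line) : measurable C -> measurable D ->
    {ae P, forall x, C x <-> D x} -> (kappa C x <= kappa D x)%R.
  move=> mC mD CD; rewrite (rmeasureID _ mC mD).
  have mCD := measurableD mC mD.
  have : p (C `\` D) = 0%R.
    suff /(negligibleP _ mCD) : P.-negligible (C `\` D) by rewrite /rmeasure => ->.
    by apply: negligibleS CD => z [Cz nDz] /= h; apply: nDz; exact/h.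
  have := kappa_le P mV V01 x mCD.
  have : (kappa (C `&` D) x <= kappa D x)%R.
    by apply: le_rmeasure => //; exact: measurableI.
  by lra.
apply/eqP; rewrite eq_le !aux//.
by apply: ae_mono AB => z [? ?]; split.
Qed.

Lemma Gamma_nbhd eps A B : unit_measurable A -> measurable (B : set line) ->
  {ae lambda, forall x, I x -> (A x <-> B x)} ->
  {ae lambda, forall x, I x -> (Gamma W eps A x <-> nbhd eps B x)}.
Proof.
move=> uA mB AB; apply: ae_mono ae_good => y gy Iy.
rewrite /Gamma/= graphon_integral// lee_fin (kappa_ae y uA.2 mB AB).
by split => [[]|].
Qed.

(** One step of [Gamma] and of [nbhd] is compared only at good points, so the iterates are compared
    up to null sets: [kappa] does not see the discrepancy, and completeness keeps the iterates of
    [Gamma] measurable. *)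
Lemma iter_Gamma eps k A : unit_measurable A ->
  unit_measurable (iter k (Gamma W eps) A) /\
  {ae lambda, forall x, I x ->
    (iter k (Gamma W eps) A x <-> iter k (nbhd eps) A x)}.
Proof.
move=> uA; elim: k => [|k [IH1 IH2]]; first by split => //; exact: aeW.
have mB := measurable_iter_nbhd P mV V01 eps k uA.2.
have h := Gamma_nbhd eps IH1 mB IH2.
split => //; split; first by move=> x [].
apply: (complete_ae_measurable (@completed_lebesgue_measure_is_complete R) _ _ _ h).
- exact: measurable_unit.
- exact: measurable_nbhd.
- by move=> x [].
Qed.

Lemma Gamma_upto_reach eps n A : unit_measurable A ->
  lambda (Gamma_upto W eps n A) = (p (reach eps n A))%:E.
Proof.
move=> uA; have mU := measurable_reach P mV V01 eps n uA.2.
rewrite rmeasureE//.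
have mG : measurable (Gamma_upto W eps n A : set line).
  by apply: bigcup_measurable => k _; have [[]] := iter_Gamma eps k uA.
have GI : Gamma_upto W eps n A `<=` I.
  by move=> x [k _]; have [[]] := iter_Gamma eps k uA => + _ _; apply.
rewrite -unit_probE//.
apply: (ae_eq_measure mG mU).
have aeN k : P.-negligible
    [set x | ~ (iter k (Gamma W eps) A x <-> iter k (nbhd eps) A x)].
  by have [_ /ae_unit_prob] := iter_Gamma eps k uA.
apply: negligibleS (negligible_bigcup aeN) => x /= nx; apply: contrapT => nU.
have h k : iter k (Gamma W eps) A x <-> iter k (nbhd eps) A x.
  by apply: contrapT => h; apply: nU; exists k.
by apply: nx; split => -[k kn kx]; exists k => //; exact/h.
Qed.

Lemma gdeg_kappa :
  {ae lambda, forall x, I x -> gdeg W x = (kappa setT x)%:E}.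
Proof.
apply: ae_mono ae_good => x gx Ix.
have uI : unit_measurable I by split => //; exact: measurable_unit.
have -> : kappa setT x = kappa I x.
  apply: kappa_ae => //; first exact: measurable_unit.
  by apply: aeW => y Iy; split.
rewrite -graphon_integral//; apply: eq_integral => y /set_mem Iy.
by congr EFin; exact: graphon_sym.
Qed.

Let lambda2_null (E : set (borel * borel)) : measurable E -> (leb \x leb) E = 0 ->
  lambda2.-negligible E.
Proof.
move=> mE E0; exists E; split => //.
  by apply: sub_caratheodory; exact: sub_sigma_algebra.
by rewrite -E0; exact: measurable_mu_extE.
Qed.

Let Ns0 : (leb \x leb) Ns = 0.
Proof.
apply/(product_null_xsection leb mNs); have /(product_null_ysection leb mN) := N0.
apply: ae_mono => x; congr (leb _ = 0); apply/seteqP; split => y;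
  by rewrite /xsection /ysection /= !in_setE.
Qed.

(** A Borel null hull [F] of the exceptional set has null sections at almost every [x]. If such an
    [x] in [0, 1] lies outside [A], then [V ^~ x] vanishes almost everywhere on [A], so [x] receives
    nothing from [A]. *)
Lemma graphon_cut0 A : unit_measurable A ->
  {ae lambda2, forall z, (A `*` (I `\` A)) z -> W z.1 z.2 = 0%R} -> cut A = 0%R.
Proof.
move=> [AI mA] [Z [mZ Z0 sZ]].
have [F mF [ZF F0]] := outer_null_hull (m := (leb \x leb)) Z0.
have mA' := measurableC mA.
have /ae_borel hF := (product_null_ysection leb mF).1 F0.
apply: EFin_inj; rewrite (edgeE P mV V01 mA mA').
transitivity (\int[P]_(x in ~` A) (0 : \bar R)); last by rewrite integral0.
have kA0 : {ae P, forall x, (~` A) x -> (kappa A x)%:E = 0}.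
  apply: ae_unit_prob; apply: ae_mono hF => x Fx Ix nAx; congr EFin.
  rewrite /rmeasure [X in fine X](_ : _ = 0)//.
  transitivity (\int[P]_(y in A) (0 : \bar R)); last by rewrite integral0.
  apply: ae_eq_integral; first exact: mA.
  - apply/measurable_EFinP; apply: measurable_funTS.
    have := measurableT_comp mV (pair2_measurable (x : line)).
    by apply: eq_measurable_fun.
  - exact: measurable_cst.
  apply: ae_unit_prob; exists (ysection F x); split => //.
    by apply: measurable_line; exact: measurable_ysection.
  move=> y /= /not_implyP[Iy /not_implyP[Ay Vyx]].
  rewrite /ysection/= in_setE; apply: ZF; apply: sZ => /= h; apply: Vyx.
  have [Syx|Syx] := pselect (S (y, x)); last by rewrite VN.
  by rewrite VE// h.
apply: ae_eq_integral kA0; first exact: mA'.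
- by apply/measurable_EFinP/measurable_funTS/measurable_kappa.
- exact: measurable_cst.
Qed.

Let measurable_line2 (E : set (borel * borel)) : measurable E ->
  measurable (E : set (line * line)).
Proof.
move=> mE; have mf : measurable_fun setT (\1_E : borel * borel -> R).
  exact: measurable_indic.
have := measurable_fun_line2 mf measurableT (measurable_set1 (1%R : R)).
rewrite setTI; congr measurable; apply/seteqP; split => z /=.
  rewrite indicE; case: (boolP (z \in E)) => [/set_mem//|_] /= /eqP.
  by rewrite eq_sym oner_eq0.
by move=> Ez; rewrite indicE mem_set.
Qed.

Let edge_null (E : set (line * line)) : measurable E ->
  (forall z, E z -> V z.1 z.2 <> 0%R) -> rmeasure nu E = 0%R -> (P \x P) E = 0.
Proof.
move=> mE EV nuE.
have : \int[P \x P]_(z in E) (V z.1 z.2)%:E = 0.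
  by rewrite -[LHS](rmeasureE nu mE) nuE.
rewrite (eq_integral (fun z : line * line => `|(V z.1 z.2)%:E|)); last first.
  by move=> z _; rewrite gee0_abs// lee_fin; have /andP[] := V01 z.1 z.2.
move/ae_eq_integral_abs => h; apply/negligibleP => //.
apply: negligibleS (h mE _); last first.
  by apply/measurable_EFinP; apply: measurable_funTS; exact: mV.
by move=> z Ez /= /(_ Ez) [] /(EV _ Ez).
Qed.

(** The two product measures live on different sigma-algebras; their null sets are compared through
    sections, which lie in [0, 1], where [P] agrees with Lebesgue measure. *)
Let borel_null (E : set (borel * borel)) : measurable E -> E `<=` I `*` I ->
  (P \x P) E = 0 -> (leb \x leb) E = 0.
Proof.
move=> mE EI E0; apply/(product_null_xsection leb mE).
have /ae_lambda h := (product_null_xsection P (measurable_line2 mE)).1 E0.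
pose B : set borel := [set x | leb (xsection E x) != 0].
have mB : measurable B.
  have := emeasurable_neq measurableT (measurable_fun_xsection leb mE) 0.
  by rewrite setTI.
suff B0 : leb B = 0 by exists B; split => // x /= /eqP.
suff /(negligibleP lambda (measurable_line mB)) : lambda.-negligible B by [].
apply: negligibleS h => x /= Bx h.
have [Ix|nIx] := pselect (I x).
  move: Bx; rewrite /B /= => /eqP; apply; rewrite -(h Ix); apply/esym/unit_probE.
  by move=> y; rewrite /xsection /= in_setE => /EI[].
move: Bx; rewrite /B /= (_ : xsection E x = set0) ?measure0 ?eqxx//.
apply/seteqP; split => // y; rewrite /xsection /= in_setE => /EI[/= Ix].
by move=> _; exact: nIx Ix.
Qed.

Lemma borel_approx (A : set line) : measurable A ->
  exists X M : set borel,
    [/\ measurable X, measurable M, leb M = 0, X `<=` A & A `<=` X `|` M].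
Proof.
move=> mA.
have : (completed_algebra_gen leb) A.
  by rewrite -g_sigma_completed_algebra_genE completed_caratheodory_measurable.
move=> [X mX [M' [M [mM M0 M'M]] <-]]; exists X, M; split => //.
by move=> x [|/M'M]; [left|right].
Qed.

Lemma cut0_graphon A : unit_measurable A -> cut A = 0%R ->
  {ae lambda2, forall z, (A `*` (I `\` A)) z -> W z.1 z.2 = 0%R}.
Proof.
move=> [AI mA] cA0; have mIA := measurableD (@measurable_unit R) mA.
(* [A] and its complement in [0, 1] need not be Borel; passing to Borel subsets [X] and [Y] makes
   [E] Borel. *)
have [X [M [mX mM M0 XA AXM]]] := borel_approx mA.
have [Y [M' [mY mM' M'0 YA AYM]]] := borel_approx mIA.
pose E : set (borel * borel) := (X `*` Y) `&` [set z | V z.1 z.2 != 0%R].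
have mE : measurable E.
  apply: measurableI; first exact: measurableX.
  have := mV_borel measurableT (measurableC (measurable_set1 (0%R : R))).
  by rewrite setTI; congr measurable; apply/seteqP; split => z /= /eqP.
have EI : E `<=` I `*` I.
  by move=> [x y] /= [[/= /XA/AI Ix /YA[Iy _]] _].
have E0 : (leb \x leb) E = 0.
  apply: borel_null => //; apply: edge_null; first exact: measurable_line2.
    by move=> z [_ /eqP].
  apply/eqP; rewrite eq_le rmeasure_ge0 andbT -cA0; apply: le_rmeasure.
  - exact: measurable_line2.
  - by apply: measurableX => //; exact: measurableC.
  - by move=> [x y] /= [[/= /XA Ax /YA[_ nAy]] _].
have MT0 : (leb \x leb) (M `*` setT) = 0.
  by rewrite product_measure1E// [X in X * _](_ : _ = 0)// mul0e.
have TM0 : (leb \x leb) (setT `*` M') = 0.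
  by rewrite product_measure1E// [X in _ * X](_ : _ = 0)// mule0.
have n1 := lambda2_null mE E0.
have n2 := lambda2_null mN N0.
have n3 := lambda2_null mNs Ns0.
have n4 := lambda2_null (measurableX mM measurableT) MT0.
have n5 := lambda2_null (measurableX measurableT mM') TM0.
(* Off [E], [N], [Ns] and the strips over [M] and [M'], the pair lies in the product of [X] and [Y],
   where [W] agrees with [V] and [V] vanishes. *)
have n1234 := negligibleU (negligibleU n1 n2) (negligibleU n3 n4).
apply: negligibleS (negligibleU n1234 n5).
move=> [x y] /= /not_implyP[[/= Ax IAy] Wxy].
have [|Mx] := AXM _ Ax; last by left; right; right.
have [Yy Xx|My] := AYM _ IAy; last by right.
have [Nxy|Nxy] := pselect (N (x, y)); first by left; left; right.
have [Nyx|Nyx] := pselect (Ns (x, y)); first by left; right; left.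
left; left; left; split => //; apply/eqP; rewrite VE//; split; last by case.
by split => /=; [exact: AI|case: IAy].
Qed.

(** * Translating the conditions between the graphon and its kernel *)

Let lambdaE A : unit_measurable A -> lambda A = (p A)%:E.
Proof. by move=> [AI mA]; rewrite rmeasureE// -unit_probE. Qed.

Let uI A : measurable (A : set line) -> unit_measurable (A `&` I).
Proof.
by move=> mA; split => // ; apply: measurableI => //; exact: measurable_unit.
Qed.

Let pI A : measurable (A : set line) -> p (A `&` I) = p A.
Proof.
move=> mA; congr fine; apply: ae_eq_measure => //; first exact: (uI mA).2.
by apply: ae_unit_prob; apply: aeW => x Ix; split => [[]|].
Qed.

Let p_unitC : p (~` I) = 0%R.
Proof.
have -> : p (~` I) = p (~` I `&` I).
  by rewrite pI//; apply: measurableC; exact: measurable_unit.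
by rewrite setICl /rmeasure measure0.
Qed.

Let p_half : p `[0%R, 2^-1%R]%classic = (2^-1)%R.
Proof.
rewrite /rmeasure [X in fine X](_ : _ = (2^-1)%:E)//.
have sub : `[0%R, 2^-1%R]%classic `<=` I.
  by move=> x /=; rewrite /unit_interval/= !in_itv/= => /andP[-> h]/=; lra.
rewrite [LHS](unit_probE sub); transitivity (leb `[0%R, 2^-1%R]%classic); first by [].
by rewrite lebesgue_measure_itv/= lte_fin invr_gt0 ltr0n -EFinB subr0.
Qed.

Lemma half_reach_connected_degree :
  (forall A, unit_measurable A -> (2^-1)%:E <= lambda A -> exists n (eps : R),
     (0 < eps)%R /\ lambda (Gamma_upto W eps n A) = 1) ->
  gconnected W /\ exists delta : R, (0 < delta)%R /\
    {ae lambda, forall x, I x -> delta%:E <= gdeg W x}.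
Proof.
move=> H.
have H' A : measurable (A : set line) -> (2^-1 <= p A)%R -> exists n (eps : R),
    (0 < eps)%R /\ p (reach eps n A) = 1%R.
  (* Intersecting [A] with [0, 1] does not change its measure, and the smaller set reaches no more
     than [A] does. *)
  move=> mA pA; have uA := uI mA.
  have [|n [eps [eps0 h]]] := H _ uA.
    by rewrite lambdaE// pI// lee_fin.
  exists n, eps; split => //.
  move: h; rewrite Gamma_upto_reach// => -[h].
  have mU := measurable_reach P mV V01 eps n mA.
  apply/eqP; rewrite eq_le; apply/andP; split.
    exact: rprobability_le1.
  rewrite -h; apply: le_rmeasure => //; first exact: (measurable_reach _ _ _ _ _ uA.2).
  move=> x [k kn kx]; exists k => //.
  by apply: iter_nbhd_mono kx => //; exact: uA.2.
have mHalf : measurable (`[0%R, 2^-1%R]%classic : set line).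
  by apply: measurable_line; exact: measurable_itv.
split.
  have conn := reach_half_connected (P := P) (mV := mV) (V01 := V01) sym_kernel_sym H'.
  move=> [A [B [[uA uB ABI AB0] [A0 B0 W0]]]].
  have BE : B = I `\` A.
    rewrite -ABI setDUl setDv set0U; apply/esym/setDidl.
    by rewrite setIC.
  rewrite BE in W0; have cA := graphon_cut0 uA W0.
  move: A0 B0; rewrite !lambdaE// !lte_fin => A0 B0.
  have [pA|pA] := conn _ uA.2 cA; first by rewrite pA ltxx in A0.
  have : (p B <= p (~` A))%R.
    apply: le_rmeasure; [exact: uB.2|by apply: measurableC; exact: uA.2|].
    by rewrite BE => x [].
  have := rmeasureID P measurableT uA.2.
  rewrite setTI setTD pA rprobability_setT.
  lra.
have [delta delta0 h] := reach_half_degree mHalf p_half H'.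
exists delta; split => //.
apply: (ae_mono2 _ gdeg_kappa (ae_lambda h)) => x hx hd Ix.
by rewrite hx// lee_fin; exact: hd.
Qed.

Lemma connected_degree_kernel (delta : R) : gconnected W -> (0 < delta)%R ->
  {ae lambda, forall x, I x -> delta%:E <= gdeg W x} ->
  {ae P, forall x, (delta <= kappa setT x)%R} /\
  forall A, measurable (A : set line) -> cut A = 0%R -> p A = 0%R \/ p A = 1%R.
Proof.
move=> conn delta0 hdeg; split.
  apply: ae_unit_prob; apply: (ae_mono2 _ gdeg_kappa hdeg) => x hx hd Ix.
  by rewrite -lee_fin -hx//; exact: hd.
move=> A mA cA; have uA := uI mA; have mI := @measurable_unit R.
have uB : unit_measurable (I `\` (A `&` I)).
  split; first by move=> x [].
  by apply: measurableD => //; exact: uA.2.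
have [mA1 mB1] := (uA.2, uB.2).
have cA1 : cut (A `&` I) = 0%R.
  apply/eqP; rewrite eq_le rmeasure_ge0 andbT.
  have mA1' := measurableC mA1; have [mA' mI'] := (measurableC mA, measurableC mI).
  (* Restricting [A] to [0, 1] adds to the cut only pairs ending outside [0, 1], which carry no
     weight. *)
  apply: (@le_trans _ _ (cut A + e (A `&` I) (~` I))%R).
    apply: le_trans (rmeasureU2 _ _ _); try exact: measurableX.
    apply: le_rmeasure.
    - exact: measurableX.
    - by apply: measurableU; exact: measurableX.
    - move=> [x y] /= [[Ax Ix] nAIy].
      have [Iy|Iy] := pselect (I y); last by right.
      by left; split => // Ay; exact: nAIy.
  by have := edge_le P mV V01 mA1 mI'; rewrite p_unitC mulr0 cA add0r.
have W0 := cut0_graphon uA cA1.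
have pB : (p (I `\` (A `&` I)) = 1 - p A)%R.
  have := rmeasureID P mI mA1.
  rewrite (_ : I `&` (A `&` I) = A `&` I); last by rewrite setIC -setIA setIid.
  have pI1 : p I = 1%R.
    by rewrite -(setTI I) (pI measurableT) rprobability_setT.
  by rewrite (pI mA) pI1; lra.
apply: contrapT => /not_orP[pA0 pA1]; apply: conn.
exists (A `&` I), (I `\` (A `&` I)); split.
  split => //; last by rewrite setDE setICA setICr setI0.
  by rewrite setDUK//; case: uA.
have pA0' : (0 < p A)%R by rewrite lt_neqAle rmeasure_ge0 andbT eq_sym; exact/eqP.
split => //; first by rewrite lambdaE// pI// lte_fin.
rewrite lambdaE// lte_fin pB subr_gt0 lt_neqAle; apply/andP; split; first exact/eqP.
exact: rprobability_le1.
Qed.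

Lemma connected_degree_reach : gconnected W ->
  (exists delta : R, (0 < delta)%R /\
    {ae lambda, forall x, I x -> delta%:E <= gdeg W x}) ->
  (exists n (eps : R), (0 < eps)%R /\ forall A, unit_measurable A ->
     (2^-1)%:E <= lambda A -> lambda (Gamma_upto W eps n A) = 1) /\
  finite_diameter W.
Proof.
move=> conn [delta [delta0 hdeg]].
(* Capping at 1 makes [delta' / 2] at most 1/2, so that sets of measure 1/2 are large enough for
   [reach_large_uniform]. *)
pose delta' := Num.min delta 1%R.
have delta'0 : (0 < delta')%R by rewrite lt_min delta0 ltr01.
have hdeg' : {ae lambda, forall x, I x -> delta'%:E <= gdeg W x}.
  apply: ae_mono hdeg => x h Ix; apply: le_trans (h Ix).
  by rewrite lee_fin ge_min lexx.
have [kdeg kconn] := connected_degree_kernel conn delta'0 hdeg'.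
split.
  have [n [eps [eps0 h]]] := reach_large_uniform (P := P) (mV := mV) (V01 := V01)
    sym_kernel_sym delta'0 kdeg kconn.
  exists n, eps; split => // A uA; rewrite lambdaE// lee_fin => pA.
  rewrite Gamma_upto_reach// h//; first exact: uA.2.
  apply: le_trans pA; rewrite ler_pdivrMr// mulVf// ?pnatr_eq0//.
  by rewrite ge_min lexx orbT.
have [n h] := reach_positive (P := P) (mV := mV) (V01 := V01)
  sym_kernel_sym delta'0 kdeg kconn.
exists n => A uA; rewrite lambdaE// lte_fin => pA.
have [eps eps0 hr] := h _ uA.2 pA.
by exists eps => //; rewrite Gamma_upto_reach// hr.
Qed.

End transfer.

Theorem theorem3p2 (R : realType) (W : graphon R) :
  [<-> finite_diameter W;
       exists (N : nat) (eps : R), (0 < eps)%R /\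
         forall A : set R, unit_measurable A ->
           (2^-1)%:E <= completed_lebesgue_measure A ->
           completed_lebesgue_measure (Gamma_upto W eps N A) = 1;
       gconnected W /\
       exists delta : R, (0 < delta)%R /\
         {ae completed_lebesgue_measure,
           forall x : R, unit_interval x -> delta%:E <= gdeg W x} ].
Proof.
have [N [mN N0 mW]] := graphon_borel W.
split => [fd|].
  (* In (i) the threshold depends on [A], so the uniform one of (ii) is obtained through (iii). *)
  apply: (fun h => (connected_degree_reach mN N0 mW h.1 h.2).1).
  apply: (half_reach_connected_degree mN N0 mW) => A uA pA.
  have [n h] := fd; have [|eps eps0 hA] := h A uA; last by exists n, eps.
  by apply: lt_le_trans pA; rewrite lte_fin invr_gt0 ltr0n.
split => [[n [eps [eps0 h]]]|[conn deg]].
  apply: (half_reach_connected_degree mN N0 mW) => A uA pA.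
  by exists n, eps; split => //; exact: h.
exact: (connected_degree_reach mN N0 mW conn deg).2.
Qed.
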